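(* Let $$A=\{\boldsymbol\theta=(\theta_1,\theta_2,\theta_3)\in(0,\pi)^3 : \theta_1+\theta_2+\theta_3=2\pi\}$$ be the set of allowable triples of angles, and for $\boldsymbol\theta\in A$ let $C(\boldsymbol\theta)$ denote the corresponding ordered triple of cross ratios. Then there is an open subset $\mathcal{U}\subset A$ of full $2$-dimensional measure in $A$ (its complement in $A$ has $2$-dimensional measure zero) such that for every $\boldsymbol\theta\in\mathcal{U}$ the triple of cross ratios is defined at $\boldsymbol\theta$ and uniquely determines $\boldsymbol\theta$ among neighboring triples: there is a neighborhood $\mathcal{U}'$ of $\boldsymbol\theta$ in $A$, on which $C$ is defined, such that $\boldsymbol\theta'\in\mathcal{U}'$ and $C(\boldsymbol\theta')=C(\boldsymbol\theta)$ imply $\boldsymbol\theta'=\boldsymbol\theta$.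
   Context: The cross ratio of four real numbers is $$R(z_1,z_2,z_3,z_4)=\frac{(z_1-z_4)(z_3-z_2)}{(z_1-z_2)(z_3-z_4)} .$$ At a generic branch point of a Blum medial axis, three smooth sheets meet; $\theta_1,\theta_2,\theta_3$ are the successive angles between their limiting tangent (half-)hyperplanes, and in the complementary sector of each angle $\theta_j$ there is one radial vector $U_j$. For each $j$, the cross ratio of the three limiting tangent hyperplanes (taken in cyclic order starting from the $j$-th) and the hyperplane determined by $U_j$ and the tangent space of the branching stratum is expressed by the $\theta_i$, giving the ordered triple of cross ratios $$C(\boldsymbol\theta)=\Big(R(0,-\tan\theta_1,\tan\theta_3,\tan\theta_2),\ R(0,-\tan\theta_2,\tan\theta_1,\tan\theta_3),\ R(0,-\tan\theta_3,\tan\theta_2,\tan\theta_1)\Big),$$ which is defined (by these formulas) at the triples $\boldsymbol\theta\in A$ with all $\theta_i\ne\frac{\pi}{2}$ and $\theta_1,\theta_2,\theta_3$ pairwise distinct. *)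

(* Defs.v *)
From HB Require Import structures.
From mathcomp Require Import all_boot all_order all_algebra.
From mathcomp Require Import all_classical all_reals all_analysis.

Set Implicit Arguments.
Unset Strict Implicit.
Unset Printing Implicit Defensive.

Import Order.TTheory GRing.Theory Num.Theory.
Import numFieldNormedType.Exports.

Local Open Scope classical_set_scope.
Local Open Scope ring_scope.

Definition cross_ratio (R : realType) (z1 z2 z3 z4 : R) : R :=
  ((z1 - z4) * (z3 - z2)) / ((z1 - z2) * (z3 - z4)).

Definition allowable (R : realType) : set (R * R * R) :=
  [set t | [/\ 0 < t.1.1 < pi, 0 < t.1.2 < pi, 0 < t.2 < pi
             & t.1.1 + t.1.2 + t.2 = 2 * pi]].

(* Division is total, so [cross_ratios] below has junk values outside this set;
   on it, all the tangents exist and no denominator vanishes, as tan is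
   injective and nonzero on (0, pi) \ {pi / 2}. *)
Definition cross_ratios_dom (R : realType) : set (R * R * R) :=
  [set t | [/\ allowable t,
      [/\ t.1.1 != pi / 2, t.1.2 != pi / 2 & t.2 != pi / 2] &
      [/\ t.1.1 != t.1.2, t.1.2 != t.2 & t.1.1 != t.2]]].

Definition cross_ratios (R : realType) (t : R * R * R) : R * R * R :=
  let: (t1, t2, t3) := t in
  (cross_ratio 0 (- tan t1) (tan t3) (tan t2),
   cross_ratio 0 (- tan t2) (tan t1) (tan t3),
   cross_ratio 0 (- tan t3) (tan t2) (tan t1)).

Definition angle_plane (R : realType) (p : R * R) : R * R * R :=
  (p.1, p.2, 2 * pi - p.1 - p.2).

(* Two-dimensional surface measure on the plane t1 + t2 + t3 = 2 pi, to be
   applied to Borel sets: in the chart [angle_plane] the area element is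
   sqrt 3 dt1 dt2. *)
Definition area (R : realType) (S : set (R * R * R)) : \bar R :=
  ((Num.sqrt 3)%:E *
   (@lebesgue_measure R \x @lebesgue_measure R) (@angle_plane R @^-1` S))%E.

(* Main.v *)
Require Import Defs.
From HB Require Import structures.
From mathcomp Require Import all_boot all_order all_algebra.
From mathcomp Require Import all_classical all_reals all_analysis.
From mathcomp Require Import ring lra.

Set Implicit Arguments.
Unset Strict Implicit.
Unset Printing Implicit Defensive.

Import Order.TTheory GRing.Theory Num.Theory.
Import numFieldNormedType.Exports.

Local Open Scope classical_set_scope.
Local Open Scope ring_scope.

(** The triple of cross ratios is injective on its whole domain, so [U] is taken
to be that domain, and every neighbourhood [U'] in the statement can be [U]
itself.

Pass to the cotangents [x], [y], [z] of the three angles.  The cross ratios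
become [(x + z) / (z - y)], [(y + x) / (x - z)] and [(z + y) / (y - x)]
([cross_ratiosE]), and the condition that the angles sum to [2 * pi] becomes
[x * y + y * z + z * x = 1] ([cot_sum]).  If [x'], [y'], [z'] have the same
cross ratios, clearing denominators gives three linear equations between the
coordinates of the cross product of [(x, y, z)] and [(x', y', z')]; these force
the cross product to vanish ([proportional_of_ratios]).  So the two triples are
proportional, and the quadratic relation leaves only the factors [1] and [-1]
([eq_up_to_sign]).  The factor [-1] would mean that each angle is replaced by
its supplement; but the supplements sum to [pi], not [2 * pi].  The factor [1]
gives equal angles because the cotangent is injective on [(0, pi)].

The domain is cut out of the allowable set by six inequations between
continuous functions, hence is relatively open.  What it omits lies on six
lines, and has area zero by Fubini: in the chart by the first two angles, every
section at a first angle other than [pi / 2] is finite. *)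

Definition cot (R : realType) (t : R) : R := cos t / sin t.

Lemma tan_cotV (R : realType) (t : R) : tan t = (cot t)^-1.
Proof. by rewrite /tan /cot invf_div. Qed.

Lemma sin_neq0 (R : realType) (t : R) : 0 < t < pi -> sin t != 0.
Proof. by move=> /sin_gt0_pi; rewrite lt0r => /andP[]. Qed.

(** [cot s = cot t] says [sin (t - s) = 0], and [|t - s| < pi]. *)
Lemma cot_inj (R : realType) (s t : R) :
  0 < s < pi -> 0 < t < pi -> cot s = cot t -> s = t.
Proof.
move=> hs ht /eqP; rewrite /cot eqr_div ?sin_neq0// => /eqP E.
have D0 : sin (t - s) = 0 by rewrite sinB; lra.
have [lst|lts|//] := ltgtP s t.
- have /sin_neq0 : 0 < t - s < pi by lra.
  by rewrite D0 eqxx.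
- have /sin_neq0 : 0 < s - t < pi by lra.
  by rewrite -opprB sinN D0 oppr0 eqxx.
Qed.

Lemma cot_neq (R : realType) (s t : R) :
  0 < s < pi -> 0 < t < pi -> s != t -> cot s != cot t.
Proof. by move=> hs ht; apply: contra => /eqP /cot_inj->. Qed.

Lemma cot_pi_sub (R : realType) (t : R) : cot (pi - t) = - cot t.
Proof.
by rewrite /cot cosB sinB cospi sinpi !mul0r addr0 sub0r !mulN1r opprK mulNr.
Qed.

Lemma cot_neq0 (R : realType) (t : R) :
  0 < t < pi -> t != pi / 2 -> cot t != 0.
Proof.
move=> ht; apply: contra => /eqP t0; apply/eqP/cot_inj => //.
  by have := pi_gt0 R; lra.
by rewrite t0 /cot cos_pihalf mul0r.
Qed.

(** This is the identity [tan a + tan b + tan c = tan a * tan b * tan c] divided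
by the product of the tangents; it holds when [a + b + c] is a multiple of [pi]
and remains valid if one of the angles is [pi / 2]. *)
Lemma cot_sum (R : realType) (a b c : R) :
  0 < a < pi -> 0 < b < pi -> 0 < c < pi -> a + b + c = 2 * pi ->
  cot a * cot b + cot b * cot c + cot c * cot a = 1.
Proof.
move=> ha hb hc abc.
have cE : c = - (a + b) + pi *+ 2 by rewrite -mulr_natl; lra.
have sE : sin c = - (sin a * cos b + cos a * sin b).
  by rewrite cE sinD2pi sinN sinD.
have coE : cos c = cos a * cos b - sin a * sin b.
  by rewrite cE cosD2pi cosN cosD.
have := sin_neq0 ha; have := sin_neq0 hb; have := sin_neq0 hc.
rewrite /cot sE coE => sc sb sa.
field; apply/and3P; split=> //.
by move: sc; apply: contra => /eqP ?; apply/eqP; lra.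
Qed.

Lemma cross_ratioV (R : realType) (x y z : R) :
  x != 0 -> y != 0 -> z != 0 -> y != z ->
  cross_ratio 0 (- x^-1) z^-1 y^-1 = (x + z) / (z - y).
Proof.
move=> x0 y0 z0 yz; rewrite /cross_ratio.
by field; rewrite x0 y0 z0 mulN1r !subr_eq0 yz eq_sym yz.
Qed.

Lemma cross_ratiosE (R : realType) (t1 t2 t3 : R) :
  cross_ratios_dom (t1, t2, t3) ->
  cross_ratios (t1, t2, t3) =
    ((cot t1 + cot t3) / (cot t3 - cot t2),
     (cot t2 + cot t1) / (cot t1 - cot t3),
     (cot t3 + cot t2) / (cot t2 - cot t1)).
Proof.
move=> [[/= h1 h2 h3 _] [n1 n2 n3] [n12 n23 n13]].
by rewrite /cross_ratios !tan_cotV !cross_ratioV ?cot_neq0 ?cot_neq// eq_sym.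
Qed.

(** Put [p = z * x' - x * z'], [q = y * z' - z * y'] and [r = x * y' - y * x'].
Cross-multiplied, the three hypotheses read [q = p + r], [p = q + r] and
[r = p + q]: each is the sum of the other two, so all vanish. *)
Lemma proportional_of_ratios (F : realFieldType) (x y z x' y' z' : F) :
  x != y -> y != z -> z != x -> x' != y' -> y' != z' -> z' != x' ->
  (x' + z') / (z' - y') = (x + z) / (z - y) ->
  (y' + x') / (x' - z') = (y + x) / (x - z) ->
  (z' + y') / (y' - x') = (z + y) / (y - x) ->
  [/\ x' * y = y' * x, y' * z = z' * y & z' * x = x' * z].
Proof.
move=> xy yz zx xy' yz' zx'.
have den (u v : F) : u != v -> v - u != 0 by rewrite subr_eq0 eq_sym.
move=> /eqP; rewrite eqr_div ?den// => /eqP E1.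
move=> /eqP; rewrite eqr_div ?den// => /eqP E2.
move=> /eqP; rewrite eqr_div ?den// => /eqP E3.
by split; lra.
Qed.

(** On a line through the origin a quadratic form takes the value 1 at no more
than two points, which are opposite. *)
Lemma eq_up_to_sign (F : realFieldType) (x y z x' y' z' : F) :
  x != 0 ->
  x' * y = y' * x -> z' * x = x' * z ->
  x * y + y * z + z * x = 1 -> x' * y' + y' * z' + z' * x' = 1 ->
  [/\ x' = x, y' = y & z' = z] \/ [/\ x' = - x, y' = - y & z' = - z].
Proof.
move=> x0 hy hz e e'; pose k := x' / x.
have xE : x' = k * x by rewrite /k divfK.
have yE : y' = k * y by rewrite /k mulrAC hy mulfK.
have zE : z' = k * z by rewrite /k mulrAC -hz mulfK.
have /eqP : k ^+ 2 = 1.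
  by rewrite -e' xE yE zE -[LHS]mulr1 -e; ring.
rewrite sqrf_eq1 xE yE zE => /orP[] /eqP ->; [left|right];
  by rewrite ?mul1r ?mulN1r.
Qed.

Lemma cross_ratios_inj (R : realType) (t t' : R * R * R) :
  cross_ratios_dom t -> cross_ratios_dom t' ->
  cross_ratios t' = cross_ratios t -> t' = t.
Proof.
case: t t' => [[t1 t2] t3] [[s1 s2] s3] dt ds.
rewrite !cross_ratiosE// => -[E1 E2 E3].
move: dt ds => [[/= h1 h2 h3 ht] [n1 n2 n3] [n12 n23 n13]].
move=> [[/= k1 k2 k3 hs] [m1 m2 m3] [m12 m23 m13]].
have [] := proportional_of_ratios _ _ _ _ _ _ E1 E2 E3;
  rewrite ?cot_neq// 1?eq_sym// => P1 _ P3.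
have [] := eq_up_to_sign (cot_neq0 h1 n1) P1 P3 (cot_sum h1 h2 h3 ht)
             (cot_sum k1 k2 k3 hs).
  by move=> [/cot_inj-> // /cot_inj-> // /cot_inj->].
(* Opposite cotangents: the angles are supplementary, so their sum is [pi]. *)
rewrite -!cot_pi_sub => -[F1 F2 F3].
have pi_sub_itv (u : R) : 0 < u < pi -> 0 < pi - u < pi by lra.
have G1 := cot_inj k1 (pi_sub_itv _ h1) F1.
have G2 := cot_inj k2 (pi_sub_itv _ h2) F2.
have G3 := cot_inj k3 (pi_sub_itv _ h3) F3.
by exfalso; have := pi_gt0 R; lra.
Qed.

(** Only the sections are constrained, and [S] is arbitrary: the product measure is
the integral of the measures of the sections, and that integrand is supported
on the single point [x0], which is null for any integrand. *)
Lemma product_lebesgue_measure0 (R : realType) (x0 : R) (S : set (R * R)) :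
  (forall x, x != x0 -> countable [set y | S (x, y)]) ->
  (@lebesgue_measure R \x @lebesgue_measure R)%E S = 0%E.
Proof.
move=> cS; rewrite /product_measure1.
rewrite (_ : _ \o _ =
  (@lebesgue_measure R \o xsection S) \_ [set x0]); last first.
  apply/funext => x; rewrite patchE; case: ifPn => // /negP nx /=.
  apply: countable_lebesgue_measure0; rewrite xsectionE; apply: cS.
  by apply/eqP => xx0; apply: nx; rewrite inE.
by rewrite -integral_mkcond integral_set1.
Qed.

(** [allowable] lies in a plane and is not open in space; these six conditions are
the part of [cross_ratios_dom] that is. *)
Definition nonexceptional (R : realType) : set (R * R * R) :=
  [set t | [/\ t.1.1 != pi / 2, t.1.2 != pi / 2 & t.2 != pi / 2]] `&`
  [set t | [/\ t.1.1 != t.1.2, t.1.2 != t.2 & t.1.1 != t.2]].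

Lemma cross_ratios_domE (R : realType) :
  @cross_ratios_dom R = @allowable R `&` @nonexceptional R.
Proof. by apply/seteqP; split=> t [] // ? []. Qed.

Lemma open_neq_fun (R : realType) (T : topologicalType) (f g : T -> R) :
  continuous f -> continuous g -> open [set t | f t != g t].
Proof.
move=> cf cg; rewrite (_ : mkset _ = (f \- g) @^-1` [set x | x != 0]).
  apply: open_comp; last exact: open_neq.
  by move=> t _; apply: continuousB; [exact: cf|exact: cg].
by apply/seteqP; split=> t /=; rewrite subr_eq0.
Qed.

Lemma open_nonexceptional (R : realType) : open (@nonexceptional R).
Proof.
have c11 : continuous (fun t : R * R * R => t.1.1).
  by move=> t; apply: cvg_comp; exact: cvg_fst.
have c12 : continuous (fun t : R * R * R => t.1.2).
  by move=> t; apply: cvg_comp; [exact: cvg_fst|exact: cvg_snd].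
have c2 : continuous (fun t : R * R * R => t.2) by move=> t; exact: cvg_snd.
have ck : continuous (fun t : R * R * R => (pi / 2 : R)).
  by move=> t; exact: cvg_cst.
have openI3 (P Q S : set (R * R * R)) : open P -> open Q -> open S ->
    open [set t | [/\ P t, Q t & S t]].
  move=> oP oQ oS; rewrite (_ : mkset _ = P `&` Q `&` S).
    by do 2 apply: openI => //.
  by apply/seteqP; split=> t [] // [].
by apply: openI; apply: openI3; exact: open_neq_fun.
Qed.

(** The line [t.1.1 = pi / 2] is vertical in the chart, which is why one abscissa
has to be excepted. *)
Lemma area_exceptional (R : realType) :
  area (@allowable R `\` @cross_ratios_dom R) = 0%E.
Proof.
rewrite /area (@product_lebesgue_measure0 _ (pi / 2)) ?mule0// => x nx.
apply/finite_set_countable.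
(* The values of the second angle where, in this order, it is [pi / 2], it equals
   the first, the third is [pi / 2], the last two agree, the first and the
   third agree. *)
apply: (@sub_finite_set _ _ [set` [:: pi / 2; x; 3 * pi / 2 - x;
  pi - x / 2; 2 * pi - 2 * x]]); last exact: finite_seq.
move=> y /= [A]; rewrite cross_ratios_domE => nD.
apply: contrapT => /negP; rewrite !inE !negb_or.
move=> /and5P[/eqP y1 /eqP y2 /eqP y3 /eqP y4 /eqP y5].
apply: nD; split=> //; split; split=> //=; apply/eqP => E;
  (apply: y1; lra) || (apply: y2; lra) || (apply: y3; lra) ||
  (apply: y4; lra) || (apply: y5; lra).
Qed.

Theorem theorem5p4 (R : realType) :
  exists U : set (R * R * R),
    [/\ exists2 V : set (R * R * R), open V & U = @allowable R `&` V,
        area (@allowable R `\` U) = 0%E &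
        forall t : R * R * R, U t ->
          cross_ratios_dom t /\
          exists U' : set (R * R * R),
            [/\ U' `<=` @allowable R,
                within (@allowable R) (nbhs t) U',
                U' `<=` @cross_ratios_dom R &
                forall t' : R * R * R,
                  U' t' -> cross_ratios t' = cross_ratios t -> t' = t]].
Proof.
exists (@cross_ratios_dom R); split.
- exists (@nonexceptional R); first exact: open_nonexceptional.
  exact: cross_ratios_domE.
- exact: area_exceptional.
- move=> t dt; split=> //; exists (@cross_ratios_dom R); split=> //.
  + by move=> ? [].
  + have [_ Vt] : (@allowable R `&` @nonexceptional R) t.
      by rewrite -cross_ratios_domE.
    rewrite withinE; exists (@nonexceptional R).
      by apply: open_nbhs_nbhs; split=> //; exact: open_nonexceptional.
    by rewrite cross_ratios_domE [LHS]setIAC setIid setIC.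
  + by move=> t' dt'; exact: cross_ratios_inj.
Qed.
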